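(* Put $G=\mathbb{R}^\times\ltimes\mathbb{R}$ and $H=\mathbb{R}^\times\subset G$. Let $\rho\colon G\to GL(\mathrm{Sym}(2,\mathbb{R}))$ be the representation given by $$\rho(g)(S):=\begin{pmatrix}a&b\\0&1\end{pmatrix}S\begin{pmatrix}a&b\\0&1\end{pmatrix}^{T}\qquad(g=(a,b)\in\mathbb{R}^\times\ltimes\mathbb{R},\ S\in\mathrm{Sym}(2,\mathbb{R})).$$ Then $v_0:=\begin{pmatrix}0&0\\0&1\end{pmatrix}\in\mathrm{Sym}(2,\mathbb{R})$ is $H$-fixed, and the family $\mathcal{P}$ obtained from $(G,H,\mathrm{Sym}(2,\mathbb{R}),v_0)$ by the method described in the context, under the identification $G/H\simeq\mathbb{R}$, $(a,b)H\mapsto b$, is the family of normal distributions on $\mathbb{R}$, $$\left\{\frac{1}{\sqrt{2\pi\sigma^2}}\exp\left(-\frac{(x-\mu)^2}{2\sigma^2}\right)dx\right\}_{(\sigma,\mu)\in\mathbb{R}_{>0}\times\mathbb{R}}.$$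
   Context: $\mathrm{Sym}(2,\mathbb{R})$ is the space of real symmetric $2\times2$ matrices. $\mathbb{R}^\times\ltimes\mathbb{R}$ is the affine group with product $(a,b)(a',b')=(aa',ab'+b)$; $H=\{(a,0)\}$. $dx$ is Lebesgue measure. The method: let $G$ be a Lie group with finitely many connected components, $H$ a closed subgroup, $X:=G/H$, $\rho\colon G\to GL(V)$ a continuous finite dimensional real representation and $v_0\in V$ an $H$-fixed vector. Put $W_0(G,H):=\{\tau\colon G\to\mathbb{R}\mid\tau\text{ is a continuous group homomorphism with }\tau|_H=0\}$. Take a nonzero relatively $G$-invariant Radon measure $\nu$ on $X$ (i.e. for some $\chi\colon G\to\mathbb{R}_{>0}$ the pushforward satisfies $g\cdot\nu=\chi(g)^{-1}\nu$ for all $g\in G$), assumed to exist; the resulting family does not depend on the choice of $\nu$. For $\theta=(\varphi,\tau)\in V^\vee\times W_0(G,H)$ and $x=gH$, put $\rho(x)v_0:=\rho(g)v_0$, $\tau(x):=\tau(g)$ and $d\tilde p_\theta(x):=\exp(-\langle\varphi,\rho(x)v_0\rangle+\tau(x))\,d\nu(x)$. Let $\Theta:=\{\theta\in V^\vee\times W_0(G,H)\mid\int_Xd\tilde p_\theta<\infty\}$ and, for $\theta\in\Theta$, $p_\theta:=(\int_Xd\tilde p_\theta)^{-1}\tilde p_\theta$. The family obtained is the set $\mathcal{P}:=\{p_\theta\}_{\theta\in\Theta}$ of probability measures on $X$. *)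

(* Defs.v *)
From HB Require Import structures.
From mathcomp Require Import all_boot all_order all_algebra.
From mathcomp Require Import all_classical all_reals all_analysis.

Set Implicit Arguments.
Unset Strict Implicit.
Unset Printing Implicit Defensive.

Import Order.TTheory GRing.Theory Num.Theory.
Import numFieldTopology.Exports numFieldNormedType.Exports.

Local Open Scope classical_set_scope.
Local Open Scope quotient_scope.
Local Open Scope ring_scope.

(* The construction below uses a Lie group only through its topological group
   structure. *)
HB.mixin Record isTopologicalGroup G & Group G & Topological G := {
  mulg_continuous : continuous (fun x : G * G => (x.1 * x.2)%g);
  invg_continuous : continuous (fun x : G => x^-1%g)
}.

#[short(type="topologicalGroupType")]
HB.structure Definition TopologicalGroup :=
  {G of Group G & Topological G & isTopologicalGroup G}.

Record closed_subgroup (G : topologicalGroupType) := ClosedSubgroup {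
  subgroup_set :> set G;
  subgroup1 : subgroup_set 1%g;
  subgroupM : forall g h,
    subgroup_set g -> subgroup_set h -> subgroup_set (g * h)%g;
  subgroupV : forall g, subgroup_set g -> subgroup_set g^-1%g;
  subgroup_closed : closed subgroup_set
}.

Section homogeneous_space.
Context {G : topologicalGroupType} (H : closed_subgroup G).

Definition same_coset (g k : G) : bool := `[< subgroup_set H (g^-1 * k)%g >].

Lemma same_coset_is_equiv : equiv_class_of same_coset.
Proof.
split=> [g|g k|k g l].
- by apply/asboolP; rewrite mulVg; exact: subgroup1.
- apply/idP/idP => /asboolP /subgroupV Hgk; apply/asboolP; move: Hgk;
    by rewrite invgM invgK.
- move=> /asboolP Hgk /asboolP Hkl; apply/asboolP.
  by have := subgroupM Hgk Hkl; rewrite -mulgA mulVKg.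
Qed.

Canonical same_coset_equiv := EquivRelPack same_coset_is_equiv.

Definition coset_space : Type :=
  quotient_topology {eq_quot same_coset_equiv}.

HB.instance Definition _ := Topological.on coset_space.
HB.instance Definition _ := Quotient.on coset_space.
HB.instance Definition _ := isPointed.Build coset_space (\pi_coset_space 1%g).

Definition coset_of (g : G) : coset_space := \pi_coset_space g.

Definition translate (g : G) (x : coset_space) : coset_space :=
  coset_of (g * repr x)%g.

End homogeneous_space.

Definition borel_type (T : ptopologicalType) := g_sigma_algebraType (@open T).

Definition radon_measure (R : realType) (T : ptopologicalType)
    (nu : {measure set (borel_type T) -> \bar R}) : Prop :=
  [/\ forall K : set T, compact K -> (nu K < +oo)%E,
      forall A : set (borel_type T), measurable A ->
        nu A = ereal_inf [set nu U | U in [set U : set T | open U /\ A `<=` U]]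
    & forall U : set T, open U ->
        nu U =
        ereal_sup [set nu K | K in [set K : set T | compact K /\ K `<=` U]]].

(* V carries no topology here: continuity of G -> GL(V) is continuity of all
   matrix coefficients. *)
Record representation (R : realType) (G : topologicalGroupType)
    (V : vectType R) := Representation {
  rep_fun :> G -> 'End(V);
  rep1 : rep_fun 1%g = \1%VF;
  repM : forall g h, rep_fun (g * h)%g = (rep_fun g \o rep_fun h)%VF;
  rep_continuous : forall (phi : 'Hom(V, R^o)) (v : V),
    continuous (fun g => phi (rep_fun g v) : R)
}.

Section exponential_family.
Context {R : realType} {G : topologicalGroupType} (H : closed_subgroup G).
Context {V : vectType R} (rho : representation G V) (v0 : V).
Local Notation X := (coset_space H).
Variable nu : {measure set (borel_type X) -> \bar R}.

Definition fixed_by : Prop := forall h, subgroup_set H h -> rho h v0 = v0.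

Definition relatively_invariant : Prop :=
  exists2 chi : G -> R, forall g, 0 < chi g &
    forall (g : G) (A : set (borel_type X)), measurable A ->
      pushforward nu (translate g : borel_type X -> borel_type X) A =
      ((chi g)^-1%:E * nu A)%E.

Definition admissible_measure : Prop :=
  [/\ radon_measure nu, nu setT <> 0%E & relatively_invariant].

Definition W0 : set (G -> R) :=
  [set tau | [/\ continuous tau,
                 forall g h, tau (g * h)%g = tau g + tau h
               & forall h, subgroup_set H h -> tau h = 0]].

(* When v0 is fixed by H and tau is in W0, the value at the coset x does not
   depend on the representative. *)
Definition tilde_density (theta : 'Hom(V, R^o) * (G -> R)) (x : X) : R :=
  expR (- theta.1 (rho (repr x) v0) + theta.2 (repr x)).

Definition tilde_p (theta : 'Hom(V, R^o) * (G -> R)) :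
    set (borel_type X) -> \bar R :=
  fun A => (\int[nu]_(x in A) (tilde_density theta x)%:E)%E.

Definition Theta : set ('Hom(V, R^o) * (G -> R)) :=
  [set theta | W0 theta.2 /\ (tilde_p theta setT < +oo)%E].

Definition exp_family : set (probability (borel_type X) R) :=
  [set p | exists2 theta, Theta theta & forall A, measurable A ->
     p A = ((fine (tilde_p theta setT))^-1%:E * tilde_p theta A)%E].

End exponential_family.

Definition pushforward_family (R : realType) d1 d2
    (T1 : measurableType d1) (T2 : measurableType d2) (f : T1 -> T2)
    (P : set (probability T1 R)) : set (probability T2 R) :=
  [set q | exists2 p, P p & forall A, measurable A -> q A = pushforward p f A].

Definition affine_group (R : realType) : Type := {p : R * R | p.1 != 0}.

Section affine_group.
Variable R : realType.
Local Notation G := (affine_group R).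

Definition lin (g : G) : R := (val g).1.
Definition trans (g : G) : R := (val g).2.

HB.instance Definition _ := Choice.on G.
HB.instance Definition _ :=
  Topological.copy G (initial_topology (val : G -> R * R)).

Lemma lin_neq0 (g : G) : lin g != 0. Proof. exact: (valP g). Qed.

Definition affine (a b : R) (a0 : a != 0) : G :=
  exist (fun p : R * R => p.1 != 0) (a, b) a0.

Definition affine_mul (g h : G) : G :=
  affine (lin g * trans h + trans g) (mulf_neq0 (lin_neq0 g) (lin_neq0 h)).
Definition affine_one : G := affine 0 (oner_neq0 R).
Definition affine_inv (g : G) : G :=
  affine (- ((lin g)^-1 * trans g)) (invr_neq0 (lin_neq0 g)).

Lemma affine_eq (g h : G) : lin g = lin h -> trans g = trans h -> g = h.
Proof.
by case: g h => [[a b] ?] [[c d] ?]; rewrite /lin /trans /= => ? ?;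
  apply: val_inj => /=; congr pair.
Qed.

Lemma affine_mulA : associative affine_mul.
Proof.
move=> g h k; apply: affine_eq; rewrite /lin /trans /= -/(lin _) ?mulrA //.
by rewrite mulrDr mulrA addrA.
Qed.
Lemma affine_mul1 : left_id affine_one affine_mul.
Proof.
by move=> g; apply: affine_eq; rewrite /lin /trans /= ?mul1r ?addr0.
Qed.
Lemma affine_mulr1 : right_id affine_one affine_mul.
Proof.
by move=> g; apply: affine_eq; rewrite /lin /trans /= ?mulr1 ?mulr0 ?add0r.
Qed.
Lemma affine_mulV : left_inverse affine_one affine_inv affine_mul.
Proof.
move=> g; apply: affine_eq; rewrite /lin /trans /= -/(lin _) -/(trans _).
  by rewrite mulVf ?lin_neq0.
by rewrite subrr.
Qed.
Lemma affine_mulrV : right_inverse affine_one affine_inv affine_mul.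
Proof.
move=> g; apply: affine_eq; rewrite /lin /trans /= -/(lin _) -/(trans _).
  by rewrite mulfV ?lin_neq0.
by rewrite mulrN mulrA mulfV ?lin_neq0// mul1r addNr.
Qed.

HB.instance Definition _ := isGroup.Build G
  affine_mulA affine_mul1 affine_mulr1 affine_mulV affine_mulrV.

Lemma linM (g h : G) : lin (g * h)%g = lin g * lin h. Proof. by []. Qed.
Lemma transM (g h : G) : trans (g * h)%g = lin g * trans h + trans g.
Proof. by []. Qed.

Lemma lin_continuous : continuous lin.
Proof.
move=> g; apply: (@continuous_comp G (R * R)%type R val fst).
  exact: initial_continuous.
exact: cvg_fst.
Qed.

Lemma trans_continuous : continuous trans.
Proof.
move=> g; apply: (@continuous_comp G (R * R)%type R val snd).
  exact: initial_continuous.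
exact: cvg_snd.
Qed.

Lemma continuous_affine (T : topologicalType) (f : T -> G) :
  continuous (lin \o f) -> continuous (trans \o f) -> continuous f.
Proof.
move=> cl ct; apply: continuous_comp_initial => x.
have fE : val \o f = fun y => ((lin \o f) y, (trans \o f) y).
  by apply/funext => y /=; rewrite /lin /trans; case: (f y) => [[]].
rewrite fE; exact: (cvg_pair (cl x) (ct x)).
Qed.

Lemma affine_mul_continuous :
  continuous (fun x : G * G => (x.1 * x.2)%g).
Proof.
have cc (f : G -> R) (p : G * G -> G) :
    continuous f -> continuous p -> continuous (f \o p).
  by move=> cf cp x; apply: continuous_comp; [exact: cp|exact: cf].
have c1 : continuous (fst : G * G -> G) by move=> x; exact: cvg_fst.
have c2 : continuous (snd : G * G -> G) by move=> x; exact: cvg_snd.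
apply: continuous_affine => x.
  exact: (cvgM (cc _ _ lin_continuous c1 x) (cc _ _ lin_continuous c2 x)).
apply: (cvgD _ (cc _ _ trans_continuous c1 x)).
exact: (cvgM (cc _ _ lin_continuous c1 x) (cc _ _ trans_continuous c2 x)).
Qed.

Lemma affine_inv_continuous : continuous (fun x : G => x^-1%g).
Proof.
have cV x : (fun g => (lin g)^-1) @ x --> (lin x)^-1.
  exact: (@cvgV _ _ _ _ lin (lin x) (lin_neq0 x) (@lin_continuous x)).
apply: continuous_affine => x; first exact: cV.
exact: (cvgN (cvgM (cV x) (@trans_continuous x))).
Qed.

HB.instance Definition _ := isTopologicalGroup.Build G
  affine_mul_continuous affine_inv_continuous.

Definition linear_part_set : set G := [set g | trans g = 0].

Lemma linear_part1 : linear_part_set 1%g. Proof. by []. Qed.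
Lemma linear_partM g h : linear_part_set g -> linear_part_set h ->
  linear_part_set (g * h)%g.
Proof.
by rewrite /linear_part_set /= transM => -> ->; rewrite mulr0 addr0.
Qed.
Lemma linear_partV g : linear_part_set g -> linear_part_set g^-1%g.
Proof.
rewrite /linear_part_set /= => g0.
by rewrite /trans /= -/(trans _) g0 mulr0 oppr0.
Qed.
Lemma linear_part_closed : closed linear_part_set.
Proof.
rewrite (_ : linear_part_set = trans @^-1` [set 0]); last by [].
by apply: closed_comp => [x _|]; [exact: trans_continuous|exact: closed_eq].
Qed.

Definition linear_part : closed_subgroup G :=
  ClosedSubgroup linear_part1 linear_partM linear_partV linear_part_closed.

Definition to_line (x : borel_type (coset_space linear_part)) : R :=
  trans (repr (x : coset_space linear_part)).

Definition Sym2_space : {vspace 'M[R]_2} := fixedSpace (linfun trmx).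
Definition Sym2 := subvs_of Sym2_space.

Lemma Sym2P (S : 'M[R]_2) : reflect (S^T = S) (S \in Sym2_space).
Proof. by apply: (iffP fixedSpaceP); rewrite lfunE. Qed.

Lemma tr_Sym2 (S : Sym2) : (vsval S)^T = vsval S.
Proof. exact/Sym2P/subvsP. Qed.

Definition mx2 (a b c d : R) : 'M[R]_2 :=
  \matrix_(i < 2, j < 2)
    if i == 0 then if j == 0 then a else b else if j == 0 then c else d.

Definition affine_mx (g : G) : 'M[R]_2 := mx2 (lin g) (trans g) 0 1.

Lemma mx2_eq (A B : 'M[R]_2) : A 0 0 = B 0 0 -> A 0 1 = B 0 1 ->
  A 1 0 = B 1 0 -> A 1 1 = B 1 1 -> A = B.
Proof.
move=> e00 e01 e10 e11; apply/matrixP => i j.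
have I2 (k : 'I_2) : k = 0 \/ k = 1.
  by case: k => [[|[|//]] lk]; [left|right]; exact: val_inj.
by case: (I2 i) => ->; case: (I2 j) => ->.
Qed.

Lemma affine_mx1 : affine_mx 1%g = 1%:M.
Proof. by apply: mx2_eq; rewrite !mxE. Qed.

Lemma affine_mxM g h : affine_mx (g * h)%g = affine_mx g *m affine_mx h.
Proof.
by apply: mx2_eq; rewrite !mxE !big_ord_recl big_ord0 !mxE /= ?linM ?transM
  ?(mul0r, mulr0, mulr1, mul1r, addr0, add0r).
Qed.

Definition congruence (A S : 'M[R]_2) : 'M[R]_2 := A *m S *m A^T.

Fact congruence_is_linear A : linear (congruence A).
Proof.
by move=> a S T; rewrite /congruence mulmxDr mulmxDl -scalemxAr -scalemxAl.
Qed.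
HB.instance Definition _ A :=
  GRing.isLinear.Build R 'M[R]_2 'M[R]_2 *:%R (congruence A)
    (congruence_is_linear A).

Definition rho_fun (g : G) : 'End(Sym2) :=
  linfun (vsproj Sym2_space \o congruence (affine_mx g) \o vsval).

Lemma rho_funE (g : G) (S : Sym2) :
  vsval (rho_fun g S) = affine_mx g *m vsval S *m (affine_mx g)^T.
Proof.
rewrite lfunE /= vsprojK //; apply/Sym2P.
by rewrite /congruence !trmx_mul trmxK tr_Sym2 mulmxA.
Qed.

Lemma rho1 : rho_fun 1%g = \1%VF.
Proof.
apply/lfunP => S; apply: val_inj; rewrite [LHS]rho_funE lfunE /=.
by rewrite affine_mx1 trmx1 mulmx1 mul1mx.
Qed.

Lemma rhoM g h : rho_fun (g * h)%g = (rho_fun g \o rho_fun h)%VF.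
Proof.
apply/lfunP => S; apply: val_inj; rewrite comp_lfunE.
rewrite [LHS]rho_funE [RHS]rho_funE.
by rewrite rho_funE affine_mxM trmx_mul !mulmxA.
Qed.

Lemma affine_mx_continuous i j : continuous (fun g => affine_mx g i j).
Proof.
rewrite (_ : (fun _ => _) = fun g =>
    if i == 0 then if j == 0 then lin g else trans g
    else if j == 0 then 0 else 1); last by apply/funext => g; rewrite mxE.
by case: (i == 0); case: (j == 0); [exact: lin_continuous|
  exact: trans_continuous|exact: cst_continuous|exact: cst_continuous].
Qed.

Lemma rho_continuous (phi : 'Hom(Sym2, R^o)) (S : Sym2) :
  continuous (fun g => phi (rho_fun g S) : R).
Proof.
pose c (i j : 'I_2) : R := phi (vsproj Sym2_space (delta_mx i j)).
have phiE (T : Sym2) : phi T = \sum_i \sum_j vsval T i j * c i j :> R.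
  rewrite -[in LHS](vsvalK T) [in LHS](matrix_sum_delta (vsval T)).
  rewrite !linear_sum; apply: eq_bigr => i _.
  by rewrite !linear_sum; apply: eq_bigr => j _; rewrite !linearZ.
rewrite (_ : (fun _ => _) = fun g => \sum_i \sum_j
    (\sum_k (\sum_l affine_mx g i l * vsval S l k) * affine_mx g j k) * c i j).
  have cS I (F : I -> G -> R) r : (forall i, continuous (F i)) ->
      continuous (fun g => \sum_(i <- r) F i g).
    by move=> cF; apply: continuous_big => //; exact: add_continuous.
  have cM (f h : G -> R) : continuous f -> continuous h ->
      continuous (fun g => f g * h g).
    by move=> cf ch g; exact: (cvgM (cf g) (ch g)).
  apply: (cS) => i; apply: (cS) => j; apply: (cM); last exact: cst_continuous.
  apply: (cS) => k; apply: (cM); last exact: affine_mx_continuous.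
  apply: (cS) => l; apply: (cM); last exact: cst_continuous.
  exact: affine_mx_continuous.
apply/funext => g; rewrite phiE rho_funE; apply: eq_bigr => i _.
apply: eq_bigr => j _; rewrite !mxE; congr (_ * _).
by apply: eq_bigr => k _; rewrite !mxE.
Qed.

Definition rho : representation G Sym2 :=
  Representation rho1 rhoM rho_continuous.

Lemma v0_sym : mx2 0 0 0 1 \in Sym2_space.
Proof. by apply/Sym2P; apply: mx2_eq; rewrite !mxE. Qed.

Definition v0 : Sym2 := Subvs v0_sym.

(* The index pair is (sigma, mu); normal_prob takes the mean first. *)
Definition normal_family : set (probability (measurableTypeR R) R) :=
  [set q | exists2 sm : R * R, 0 < sm.1 &
     forall A, measurable A -> q A = normal_prob sm.2 sm.1 A].

End affine_group.

Arguments normal_family : clear implicits.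
Arguments to_line : clear implicits.

(* Main.v *)
(* Identify G/H with the line through (a, b)H |-> b, on which g = (a, b) acts by
   x |-> a x + b. The reflections x |-> b - x are involutions, so they have
   factor 1 for any relatively invariant Radon measure and lie in the kernel of
   any homomorphism to R. Since a translation is a product of two reflections,
   such a measure is translation invariant, hence a multiple of Lebesgue
   measure; since reflections and H generate G, W0(G, H) = 0. The density is
   then exp(- (alpha x^2 + beta x + gamma)) with alpha and beta arbitrary, and
   it is integrable iff alpha > 0, that is, iff it is Gaussian up to a
   constant. *)

Require Import Defs.
From HB Require Import structures.
From mathcomp Require Import all_boot all_order all_algebra.
From mathcomp Require Import all_classical all_reals all_analysis.
From mathcomp Require Import measurable_realfun ring lra.

Set Implicit Arguments.
Unset Strict Implicit.
Unset Printing Implicit Defensive.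

Import Order.TTheory GRing.Theory Num.Theory.
Import numFieldTopology.Exports numFieldNormedType.Exports.

Local Open Scope classical_set_scope.
Local Open Scope ring_scope.

(** * Additive functions and translation-invariant measures on the line *)

(** Nonnegativity makes [f] nondecreasing, so [f y] stays within [f 1] of [y * f 1]. Passing from
    [x] to [x *+ n] multiplies the error by [n] under the same bound, so the error vanishes. *)
Lemma additive_ge0_linear (R : realType) (f : R -> R) :
  (forall x y, 0 <= x -> 0 <= y -> f (x + y) = f x + f y) ->
  (forall x, 0 <= x -> 0 <= f x) ->
  forall x, 0 <= x -> f x = x * f 1.
Proof.
move=> fD f_ge0.
have f_le x y : 0 <= x -> x <= y -> f x <= f y.
  move=> x0 xy; have := fD x (y - x) x0; rewrite subr_ge0 => /(_ xy).
  by rewrite addrC subrK => ->; rewrite lerDl f_ge0// subr_ge0.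
have fMn x n : 0 <= x -> f (x *+ n) = f x *+ n.
  move=> x0; elim: n => [|n IHn]; last first.
    by rewrite !mulrS fD ?mulrn_wge0// IHn.
  by have := fD 0 0 (lexx 0) (lexx 0); rewrite !mulr0n addr0; lra.
(* With [m] the integer part of [y], both [f y] and [y * f 1] lie between [m * f 1] and
   [(m + 1) * f 1]. *)
have f_near y : 0 <= y -> `|f y - y * f 1| <= f 1.
  move=> y0; have /andP[] := truncn_itv y0; set m := Num.truncn y => my ym.
  have := f_le _ _ y0 (ltW ym); have := f_le _ _ (ler0n R m) my.
  rewrite fMn// fMn// -[f 1 *+ m]mulr_natl -[f 1 *+ _]mulr_natl.
  move: my ym; rewrite -natr1 => my ym l u.
  have f1 := f_ge0 1 ler01.
  have := ler_wpM2r f1 my; have := ler_wpM2r f1 (ltW ym).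
  by rewrite ler_norml mulrDl mul1r; move: u; rewrite mulrDl mul1r; lra.
move=> x x0; apply/eqP; rewrite -subr_eq0 -normr_le0 leNgt; apply/negP.
set d := `| _ | => d0.
(* The factor [n] is chosen so that [n * d > f 1], which contradicts [f_near]. *)
have := f_near (x *+ (Num.truncn (f 1 / d)).+1) (mulrn_wge0 _ x0).
apply/negP; rewrite -ltNge fMn// mulrnAl -mulrnBl normrMn -/d.
by rewrite -mulr_natl -ltr_pdivrMr// truncnS_gt.
Qed.

(** Hides the measure structure of the pushforward, which depends on the proof [mf], so that later
    arguments see only its values. *)
Lemma measure_pushforward d1 d2 (T1 : measurableType d1)
    (T2 : measurableType d2) (R : realType)
    (m : {measure set T1 -> \bar R}) (f : T1 -> T2) :
  measurable_fun setT f ->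
  exists n : {measure set T2 -> \bar R}, forall A, n A = m (f @^-1` A).
Proof.
move=> mf; by exists
  (measure_function_pushforward__canonical__measure_function_Measure m mf).
Qed.

Section lebesgue_uniqueness.
Context {R : realType}.
Local Notation lambda := (@lebesgue_measure R).
Implicit Type mu : {measure set (measurableTypeR R) -> \bar R}.

Lemma measure_segment_additive mu :
  (forall (t : R) (A : set (measurableTypeR R)), measurable A ->
    mu ((fun x : R => x + t) @^-1` A) = mu A) ->
  forall x y : R, 0 <= x -> 0 <= y ->
    (mu `]0%R, (x + y)%R]%classic =
     mu `]0%R, x]%classic + mu `]0%R, y]%classic)%E.
Proof.
move=> mu_shift x y x0 y0.
rewrite -(mu_shift (- x) `]0, y]%classic)//.
have -> : (fun z => z - x) @^-1` `]0, y] = `]x, x + y]%classic.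
  by apply/seteqP; split => z /=; rewrite !in_itv/= subr_gt0 lerBlDl.
rewrite -measureU//.
  congr (mu _); apply/seteqP; split => z /=; rewrite !in_itv/=.
    by have [] := leP z x => zx /andP[z0 zxy]; [left|right]; lra.
  by case; lra.
by apply/seteqP; split => z //=; rewrite !in_itv/=; lra.
Qed.

(** The measure of []0, x]] is additive and nonnegative in [x], hence linear; its slope is the
    constant. *)
Lemma shift_invariant_lebesgue mu :
  (forall (t : R) (A : set (measurableTypeR R)), measurable A ->
    mu ((fun x : R => x + t) @^-1` A) = mu A) ->
  (forall x : R, mu `]0%R, x]%classic < +oo)%E ->
  exists c : {nonneg R}, forall A, measurable A ->
    mu A = (c%:num%:E * lambda A)%E.
Proof.
move=> mu_shift mu_fin; pose f x := fine (mu `]0, x]%classic).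
have fE x : mu `]0, x]%classic = (f x)%:E by rewrite fineK// ge0_fin_numE.
have f_lin : forall x, 0 <= x -> f x = x * f 1.
  apply: additive_ge0_linear => [x y x0 y0|x _]; last exact: fine_ge0.
  by apply: EFin_inj; rewrite EFinD -!fE measure_segment_additive.
have f1_ge0 : 0 <= f 1 by exact: fine_ge0.
pose c := NngNum f1_ge0; exists c => A mA.
have muE (a b : R) : mu `]a, b]%classic = ((f 1)%:E * lambda `]a, b]%classic)%E.
  rewrite lebesgue_measure_itv/= lte_fin; case: ltP => [ab|ba]; last first.
    by rewrite set_itv_ge ?measure0 ?mule0// -leNgt bnd_simp.
  rewrite -(mu_shift a)//.
  have -> : (fun z => z + a) @^-1` `]a, b] = `]0, b - a]%classic.
    by apply/seteqP; split => z /=; rewrite !in_itv/= ltrDr lerBrDr.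
  by rewrite fE f_lin ?subr_ge0 ?(ltW ab)// mulrC EFinM.
(* Half-open intervals form a generating family stable under intersection, and the []-n, n]] exhaust
   the line with finite measure. *)
apply: (@measure_unique _ _ (measurableTypeR R) (@ocitv R)
  (fun n => `]- n%:R, n%:R]%classic) _ _ _ _ mu (mscale c lambda)) => //.
- exact: ocitvI.
- by move=> n; exact: is_ocitv.
- exact: bigcup_itvT.
- by move=> _ [[a b] _ <-]; rewrite /= /mscale muE.
- move=> n /=; rewrite muE lebesgue_measure_itv/=.
  by case: ifP => _; rewrite ?mule0 ?ltry.
Qed.

(** The pushforward of [lambda] scaled by [|a|] agrees with [lambda] on half-open intervals, so it
    is [lambda] by uniqueness. *)
Lemma lebesgue_measure_affine (a b : R) (A : set (measurableTypeR R)) :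
  a != 0 -> measurable A ->
  lambda ((fun x : R => a * x + b) @^-1` A) = (`|a|^-1%:E * lambda A)%E.
Proof.
move=> a0 mA; have a_gt0 : 0 < `|a| by rewrite normr_gt0.
have mf : measurable_fun setT (fun x => a * x + b : measurableTypeR R).
  by apply: measurable_funD => //; exact: measurable_funM.
have [m mE] := measure_pushforward lambda mf.
rewrite -mE [in RHS](@lebesgue_measure_unique R
  (mscale (NngNum (ltW a_gt0)) m))//.
  by rewrite /= /mscale/= muleA -EFinM mulVf ?mul1e ?gt_eqF.
move=> _ [[x y] _ <-]; rewrite /= /mscale/= mE.
(* A negative slope swaps the endpoints, and with them the closed side of the interval. *)
have -> : (fun z : R => a * z + b) @^-1` `]x, y] =
    if 0 < a then `](x - b) / a, (y - b) / a]%classic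
    else `[(y - b) / a, (x - b) / a[%classic.
  case: ltP => [a0'|a0']; apply/seteqP; split => z /=; rewrite !in_itv/=.
  - by rewrite ltr_pdivrMr// ler_pdivlMr// lerBrDr ltrBlDr mulrC.
  - by rewrite ltr_pdivrMr// ler_pdivlMr// lerBrDr ltrBlDr mulrC.
  - have {}a0' : a < 0 by rewrite lt_neqAle a0.
    by rewrite ltr_ndivlMr// ler_ndivrMr// lerBrDr ltrBlDr mulrC andbC.
  - have {}a0' : a < 0 by rewrite lt_neqAle a0.
    by rewrite ltr_ndivlMr// ler_ndivrMr// lerBrDr ltrBlDr mulrC andbC.
case: ltP => [a0'|a0'].
  rewrite /= !lebesgue_measure_itv/= !lte_fin ltr_pM2r ?invr_gt0// ltrD2r.
  case: ifP => _; rewrite ?mule0//.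
  rewrite gtr0_norm// -!EFinB -EFinM; congr EFin; field.
  by rewrite gt_eqF.
have {}a0' : a < 0 by rewrite lt_neqAle a0.
rewrite /= !lebesgue_measure_itv/= !lte_fin ltr_nM2r ?invr_lt0// ltrD2r.
case: ifP => _; rewrite ?mule0//.
rewrite ltr0_norm// -!EFinB -EFinM; congr EFin; field.
by rewrite lt_eqF.
Qed.

End lebesgue_uniqueness.

(** * The homeomorphism between the coset space and the line *)

Section line_homeomorphism.
Variable R : realType.
Local Notation H := (linear_part R).
Local Notation X := (coset_space H).

(** The translation by [x] serves as a continuous choice of representative. *)
Definition of_line (x : R) : X := coset_of H (affine x (oner_neq0 R)).

Lemma same_coset_trans (g k : affine_group R) :
  same_coset H g k = (trans g == trans k).
Proof.
have e : trans (g^-1 * k)%g = (lin g)^-1 * (trans k - trans g).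
  by rewrite transM {1}/lin {2}/trans /= -/(lin _) -/(trans _) mulrBr.
apply/asboolP/eqP => [|gk].
  rewrite /= /linear_part_set /= e => /eqP.
  by rewrite mulf_eq0 invr_eq0 (negbTE (lin_neq0 g))/= subr_eq0 => /eqP.
by rewrite /= /linear_part_set /= e gk subrr mulr0.
Qed.

Lemma coset_of_eq (g k : affine_group R) :
  (coset_of H g = coset_of H k) <-> (trans g = trans k).
Proof.
split=> [/eqmodP|gk].
  by rewrite /= same_coset_trans => /eqP.
by apply/eqmodP; rewrite /= same_coset_trans gk.
Qed.

Lemma to_line_coset (g : affine_group R) :
  to_line R (coset_of H g) = trans g.
Proof. by apply/coset_of_eq; rewrite /coset_of reprK. Qed.

Lemma of_lineK : cancel of_line (to_line R).
Proof. by move=> x; rewrite to_line_coset. Qed.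

Lemma to_lineK : cancel (to_line R) of_line.
Proof.
move=> x; rewrite -[RHS]reprK; apply/coset_of_eq.
by rewrite [LHS]/trans.
Qed.

(** Although [repr] is an arbitrary choice, [trans] is continuous and constant on cosets, so it
    descends to the quotient topology. *)
Lemma continuous_to_line : continuous (to_line R : X -> R).
Proof.
apply: (@repr_comp_continuous _ _ _ (@trans R)); first exact: trans_continuous.
by move=> g k /eqP /coset_of_eq ->.
Qed.

Lemma continuous_of_line : continuous of_line.
Proof.
move=> y; apply: continuous_comp; last exact: pi_continuous.
by apply: continuous_affine; [exact: cst_continuous|move=> x; exact: cvg_id].
Qed.

Lemma to_line_translate (g : affine_group R) (x : X) :
  to_line R (translate g x) = lin g * to_line R x + trans g.
Proof. by rewrite to_line_coset transM. Qed.

Lemma translate_of_line (g : affine_group R) (x : R) :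
  translate g (of_line x) = of_line (lin g * x + trans g).
Proof. by apply: (can_inj to_lineK); rewrite to_line_translate !of_lineK. Qed.

Lemma measurable_to_line :
  measurable_fun setT (to_line R : borel_type X -> measurableTypeR R).
Proof.
apply: (measurability _ (RGenOpens.measurableE R)).
move=> _ [_ [a [b ->]] <-]; rewrite setTI; apply: sub_sigma_algebra.
have /continuousP := continuous_to_line; apply; exact: interval_open.
Qed.

Lemma measurable_of_line :
  measurable_fun setT (of_line : measurableTypeR R -> borel_type X).
Proof.
apply: (@measurability _ _ (measurableTypeR R) (borel_type X) _ _
  (@open X)) => //.
move=> _ [A oA <-]; rewrite setTI; apply: open_measurable.
by have /continuousP := continuous_of_line; apply.
Qed.

End line_homeomorphism.

(** * Admissible measures: existence, and uniqueness up to a factor *)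

Section admissible_measures.
Variable R : realType.
Local Notation H := (linear_part R).
Local Notation X := (coset_space H).
Local Notation lambda := (@lebesgue_measure R).

(** Rewriting preimages as images under the inverse lets compactness follow from continuity. *)
Lemma preimage_of_line (A : set X) : @of_line R @^-1` A = to_line R @` A.
Proof.
apply/seteqP; split=> [x Ax|_ [y Ay <-]].
  by exists (of_line x); rewrite ?of_lineK.
by rewrite /= to_lineK.
Qed.

Lemma preimage_to_line (A : set R) : to_line R @^-1` A = @of_line R @` A.
Proof.
apply/seteqP; split=> [x Ax|_ [y Ay <-]].
  by exists (to_line R x); rewrite ?to_lineK.
by rewrite /= of_lineK.
Qed.

Lemma compact_preimage_of_line (K : set X) :
  compact K -> compact (@of_line R @^-1` K).
Proof.
rewrite preimage_of_line => cK; apply: continuous_compact => //.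
exact/continuous_subspaceT/continuous_to_line.
Qed.

Lemma compact_preimage_to_line (K : set R) :
  compact K -> compact (to_line R @^-1` K : set X).
Proof.
rewrite preimage_to_line => cK; apply: continuous_compact => //.
exact/continuous_subspaceT/continuous_of_line.
Qed.

Lemma open_preimage_of_line (U : set X) : open U -> open (@of_line R @^-1` U).
Proof. by have /continuousP := @continuous_of_line R; apply. Qed.

Lemma open_preimage_to_line (U : set R) :
  open U -> open (to_line R @^-1` U : set X).
Proof. by have /continuousP := @continuous_to_line R; apply. Qed.

Lemma preimage_of_lineK (A : set X) : to_line R @^-1` (@of_line R @^-1` A) = A.
Proof. by apply/seteqP; split => x /=; rewrite to_lineK. Qed.

Lemma preimage_to_lineK (A : set R) :
  @of_line R @^-1` (to_line R @^-1` A : set X) = A.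
Proof. by apply/seteqP; split => x /=; rewrite of_lineK. Qed.

Lemma measurable_preimage_of_line (A : set (borel_type X)) :
  measurable A -> measurable (@of_line R @^-1` A : set (measurableTypeR R)).
Proof. by move=> mA; rewrite -[_ @^-1` _]setTI; exact: measurable_of_line. Qed.

Lemma measurable_preimage_to_line (A : set (measurableTypeR R)) :
  measurable A -> measurable (to_line R @^-1` A : set (borel_type X)).
Proof. by move=> mA; rewrite -[_ @^-1` _]setTI; exact: measurable_to_line. Qed.

Lemma preimage_translate (g : affine_group R) (A : set R) :
  translate g @^-1` (to_line R @^-1` A : set X) =
  to_line R @^-1` ((fun x : R => lin g * x + trans g) @^-1` A).
Proof. by apply/seteqP; split => x; rewrite /preimage/= to_line_translate. Qed.

(** Compact, open and measurable sets correspond under the homeomorphism, so the regularity of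
    Lebesgue measure carries over. *)
Lemma radon_lebesgue (nu : {measure set (borel_type X) -> \bar R}) :
  (forall A, nu A = lambda (@of_line R @^-1` A)) -> radon_measure nu.
Proof.
move=> nuE; split=> [K cK|A mA|U oU].
- by rewrite nuE compact_finite_measure//; exact: compact_preimage_of_line.
- rewrite nuE; have mA' := measurable_preimage_of_line mA.
  apply/eqP; rewrite eq_le; apply/andP; split.
    apply: le_ereal_inf_tmp => _ [U [oU AU] <-]; rewrite nuE le_measure ?inE//.
      by apply: open_measurable; exact: open_preimage_of_line.
    by move=> x /AU.
  (* Outer approximation up to [e] is applied at finite measure; at infinite measure the bound is
     trivial. *)
  have [Aoo|] := ltP (lambda (@of_line R @^-1` A)) +oo%E; last first.
    by rewrite leye_eq => /eqP ->; exact: leey.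
  apply/lee_addgt0Pr => e e0.
  have [U [oU AU Ue]] := lebesgue_regularity_outer mA' Aoo e0.
  apply: (@le_trans _ _ (lambda U)).
    apply: ereal_inf_lbound; exists (to_line R @^-1` U); last first.
      by rewrite nuE preimage_to_lineK.
    split; first exact: open_preimage_to_line.
    by move=> x Ax; apply: AU; rewrite /preimage/= to_lineK.
  have mU := open_measurable oU.
  rewrite -(setDKU AU) measureU//; last by rewrite setDKI.
    by rewrite addeC leeD2l// ltW.
  exact: measurableD.
- rewrite nuE lebesgue_regularity_inner_sup; last first.
    by apply: open_measurable; exact: open_preimage_of_line.
  congr ereal_sup; apply/seteqP; split => _ [K [cK KU] <-].
    exists (to_line R @^-1` K); last by rewrite nuE preimage_to_lineK.
    split; first exact: compact_preimage_to_line.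
    by move=> x /KU; rewrite /preimage/= to_lineK.
  exists (@of_line R @^-1` K); last by rewrite nuE.
  by split; [exact: compact_preimage_of_line|move=> x /KU].
Qed.

Lemma exists_admissible :
  exists nu : {measure set (borel_type X) -> \bar R}, admissible_measure nu.
Proof.
have [nu nuE] := measure_pushforward lambda (@measurable_of_line R).
exists nu; split; first exact: radon_lebesgue.
- by rewrite nuE preimage_setT -(@set_itvNyy _ R) /= lebesgue_measure_itv.
(* Pulling back along [x |-> a x + b] divides Lebesgue measure by [|a|]. *)
- exists (fun g => `|lin g|) => [g|g A mA]; first by rewrite normr_gt0 lin_neq0.
  rewrite /pushforward !nuE -(lebesgue_measure_affine (trans g)) ?lin_neq0//;
    last first.
    exact: measurable_preimage_of_line.
  congr lebesgue_measure; apply/seteqP.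
  by split => x; rewrite /preimage/= translate_of_line.
Qed.

Section uniqueness.
Variable nu : {measure set (borel_type X) -> \bar R}.
Hypothesis nu_adm : admissible_measure nu.

(** By inner regularity of the whole space, null compact sets would make [nu] zero. *)
Lemma admissible_compact_neq0 : exists2 K : set X, compact K & nu K != 0.
Proof.
have [[_ _ inner] nuT _] := nu_adm.
apply: contrapT => noK; apply: nuT; rewrite inner; last exact: openT.
apply/eqP; rewrite eq_le; apply/andP; split.
  apply: ge_ereal_sup => _ [K [cK _] <-].
  rewrite leNgt; apply/negP => K0; apply: noK; exists K => //.
  by rewrite gt_eqF.
apply: ereal_sup_ubound; exists set0; last exact: measure0.
by split; [exact: compact0|].
Qed.

(* A reflection is an involution, so its factor chi satisfies chi ^+ 2 = 1. *)
Lemma reflection_invariant (g : affine_group R) (A : set (borel_type X)) :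
  lin g = -1 -> measurable A ->
  nu (translate g @^-1` A) = nu A.
Proof.
move=> lg mA; have [[K_fin _ _] _ [chi chi_gt0 nu_chi]] := nu_adm.
have gK (B : set X) : translate g @^-1` (translate g @^-1` B) = B.
  apply/seteqP; split => x;
  rewrite /preimage/= -[x]to_lineK !translate_of_line lg;
  by rewrite !mulN1r opprD opprK addrNK.
have mg (B : set (borel_type X)) :
    measurable B -> measurable (translate g @^-1` B : set (borel_type X)).
  rewrite -[B in _ -> _ (_ @^-1` B)]preimage_of_lineK preimage_translate.
  move=> mB; apply: measurable_preimage_to_line.
  rewrite -[X in measurable X]setTI.
  suff: measurable_fun setT
      (fun x : R => lin g * x + trans g : measurableTypeR R).
    by move=> mf; apply: mf => //; exact: measurable_preimage_of_line.
  by apply: measurable_funD => //; exact: measurable_funM.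
suff chi1 : chi g = 1.
  by have := nu_chi g A mA; rewrite chi1 invr1 mul1e.
(* Applying the factor twice gives [(chi g)^-2 * nu K = nu K]; as [nu K] is finite and nonzero, it
   cancels. *)
have [K cK K0] := admissible_compact_neq0.
have mK : measurable (K : set (borel_type X)).
  rewrite -[K]preimage_of_lineK; apply: measurable_preimage_to_line.
  by apply: compact_measurable; exact: compact_preimage_of_line.
have nuK_fin : nu K \is a fin_num by rewrite ge0_fin_numE// K_fin.
have := nu_chi g _ (mg _ mK); rewrite /pushforward gK.
have := nu_chi g _ mK; rewrite /pushforward => ->.
move: K0; rewrite -(fineK nuK_fin) eqe -!EFinM => K0 [/eqP].
 rewrite mulrA -[X in X == _]mul1r (inj_eq (mulIf K0)) eq_sym -expr2.
rewrite sqrp_eq1 ?invr_ge0 ?(ltW (chi_gt0 g))// => /eqP chi1.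
by rewrite -[chi g]invrK chi1 invr1.
Qed.

Lemma admissible_lebesgue : exists2 c : {nonneg R}, 0 < c%:num &
  forall A, measurable A -> nu A = (c%:num%:E * lambda (@of_line R @^-1` A))%E.
Proof.
have [[K_fin _ _] nuT _] := nu_adm.
have [mu muE] := measure_pushforward nu (@measurable_to_line R).
have N1 : -1 != 0 :> R by rewrite oppr_eq0 oner_eq0.
have mu_refl b (A : set (measurableTypeR R)) : measurable A ->
    mu ((fun x : R => - x + b) @^-1` A) = mu A.
  move=> mA; rewrite !muE -[RHS](@reflection_invariant (affine b N1))//;
    last first.
    exact: measurable_preimage_to_line.
  rewrite preimage_translate; congr (nu (_ @^-1` _)).
  by apply/seteqP; split => x; rewrite /preimage/= mulN1r.
have [t A mA|x|c muc] := @shift_invariant_lebesgue R mu.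
- (* The translation by t is a product of two reflections. *)
  rewrite -[RHS](mu_refl t)// -[RHS](mu_refl 0)//.
    congr (mu _); apply/seteqP.
    by split => x; rewrite /preimage/= opprD opprK oppr0 addr0.
  rewrite -[X in measurable X]setTI.
  suff: measurable_fun setT (fun x : R => - x + t : measurableTypeR R).
    by move=> mf; exact: mf.
  by apply: measurable_funD => //; exact: measurable_funN.
(* Finiteness comes from the compact segment [[0, x]]. *)
- rewrite muE; apply: (@le_lt_trans _ _ (nu (to_line R @^-1` `[0, x]%classic))).
    apply: le_measure; rewrite ?inE; try exact: measurable_preimage_to_line.
    by move=> y; rewrite /preimage/= !in_itv/= => /andP[/ltW -> ->].
  by apply/K_fin/compact_preimage_to_line; exact: segment_compact.
have nuE A : measurable A -> nu A = (c%:num%:E * lambda (@of_line R @^-1` A))%E.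
  move=> mA; rewrite -muc ?muE ?preimage_of_lineK//.
  exact: measurable_preimage_of_line.
exists c => //; rewrite lt_neqAle [0 <= _]ge0 andbT.
apply/eqP => c0; apply: nuT; rewrite nuE ?preimage_setT -?c0 ?mul0e//.
Qed.

End uniqueness.
End admissible_measures.

(** * The densities in the coordinate of the line *)

Section normal_family.
Variable R : realType.
Local Notation H := (linear_part R).
Local Notation X := (coset_space H).
Local Notation lambda := (@lebesgue_measure R).

Lemma sym2_subproof (a b d : R) : mx2 a b b d \in Sym2_space R.
Proof. by apply/Sym2P; apply: mx2_eq; rewrite !mxE. Qed.

Definition sym2 (a b d : R) : Sym2 R := Subvs (sym2_subproof a b d).

(** Since [v0] is the square [e e^T] of the second basis vector, its image is the square of the
    column [(b, 1)] with [b = trans g]. Linear forms on the orbit are thus quadratic polynomials in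
    [b]. *)
Lemma rho_v0E (g : affine_group R) :
  rho R g (v0 R) =
  trans g ^+ 2 *: sym2 1 0 0 + trans g *: sym2 0 1 0 + v0 R.
Proof.
apply: val_inj; rewrite [LHS]rho_funE.
apply: mx2_eq; rewrite !mxE !big_ord_recl !big_ord0 !mxE /= !big_ord_recl;
  rewrite !big_ord0 !mxE /=; ring.
Qed.

Lemma fixed_by_v0 : fixed_by H (rho R) (v0 R).
Proof. by move=> h h0; rewrite rho_v0E h0 expr0n/= !scale0r !add0r. Qed.

(* The reflection s at trans g is an involution and s * g lies in H. *)
Lemma W0_eq0 (tau : affine_group R -> R) : W0 H tau -> forall g, tau g = 0.
Proof.
move=> [_ tauM tauH] g.
have N1 : -1 != 0 :> R by rewrite oppr_eq0 oner_eq0.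
pose s := affine (trans g) N1.
have H1 : subgroup_set H (s * s)%g.
  by rewrite /= /linear_part_set /= transM mulN1r addNr.
have H2 : subgroup_set H (s * g)%g.
  by rewrite /= /linear_part_set /= transM mulN1r addNr.
by have := tauH _ H1; have := tauH _ H2; rewrite !tauM; lra.
Qed.

(** The density on the line; [a], [b], [c] will be the values of the linear form at [sym2 1 0 0],
    [sym2 0 1 0] and [v0]. *)
Definition quadratic_exp (a b c x : R) : R := expR (- (a * x ^+ 2 + b * x + c)).

Lemma measurable_quadratic_exp a b c :
  measurable_fun setT (quadratic_exp a b c : measurableTypeR R -> R).
Proof.
apply: measurableT_comp => //; apply: measurable_funN.
apply: measurable_funD => //.
apply: measurable_funD; last exact: measurable_funM.
by apply: measurable_funM => //; exact: measurable_funX.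
Qed.

Lemma quadratic_exp_normal_pdf (m s c : R) : 0 < s ->
  exists2 K, 0 < K & forall x,
    quadratic_exp (s ^+ 2 *+ 2)^-1 (- (m / s ^+ 2)) c x = K * normal_pdf m s x.
Proof.
move=> s0; have s_neq0 : s != 0 by rewrite gt_eqF.
(* The exponential is what remains after completing the square; the division removes the normalizing
   factor of the normal density. *)
exists (expR (m ^+ 2 / (s ^+ 2 *+ 2) - c) / normal_peak s).
  by rewrite divr_gt0 ?expR_gt0 ?normal_peak_gt0.
move=> x; rewrite normal_pdfE// mulrA divfK ?gt_eqF ?normal_peak_gt0//.
rewrite /normal_fun /quadratic_exp -expRD; congr expR; field.
by rewrite s_neq0.
Qed.

(** On a half-line where [b * x <= 0], the integrand is at least [expR (- c)], and the half-line has
    infinite measure. *)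
Lemma integral_quadratic_exp_nonpos (a b c : R) : a <= 0 ->
  (\int[lambda]_x (quadratic_exp a b c x)%:E = +oo)%E.
Proof.
move=> a0.
(* The half-line on which b * x <= 0. *)
pose D : set R := if b <= 0 then `[0, +oo[%classic else `]-oo, 0]%classic.
have mD : measurable (D : set (measurableTypeR R)).
  by rewrite /D; case: ifP => _; exact: measurable_itv.
have lD : lambda D = +oo%E.
  by rewrite /D; case: ifP => _; rewrite lebesgue_measure_itv/= ?ltry ?ltNyr.
have mf : measurable_fun setT
    (fun x : measurableTypeR R => (quadratic_exp a b c x)%:E).
  by apply/measurable_EFinP; exact: measurable_quadratic_exp.
apply/eqP; rewrite -leye_eq.
have eD : (\int[lambda]_(x in D) (expR (- c))%:E = +oo)%E.
  by rewrite integral_cst//= lD gt0_muley// lte_fin expR_gt0.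
rewrite -[leLHS]eD.
apply: (@le_trans _ _ (\int[lambda]_(x in D) (quadratic_exp a b c x)%:E)%E).
  apply: ge0_le_integral => //.
  - exact: measurable_funTS.
  - move=> x Dx; rewrite lee_fin ler_expR lerN2 gerDr.
    have bx : b * x <= 0.
      move: Dx; rewrite /D; case: (leP b 0) => b0 /=;
        rewrite in_itv/= ?andbT => x0.
        exact: mulr_le0_ge0.
      by rewrite mulr_ge0_le0// ltW.
    have : a * x ^+ 2 <= 0 by rewrite mulr_le0_ge0 ?sqr_ge0.
    by move: bx; lra.
apply: ge0_subset_integral => //.
by move=> x _; rewrite lee_fin expR_ge0.
Qed.

Section with_measure.
Variables (nu : {measure set (borel_type X) -> \bar R}) (k : {nonneg R}).
Hypothesis nuE : forall A, measurable A ->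
  nu A = (k%:num%:E * lambda (@of_line R @^-1` A))%E.
Variable theta : 'Hom(Sym2 R, R^o) * (affine_group R -> R).
Hypothesis theta_W0 : W0 H theta.2.

Lemma tilde_densityE (x : X) : tilde_density (rho R) (v0 R) theta x =
  quadratic_exp (theta.1 (sym2 1 0 0)) (theta.1 (sym2 0 1 0)) (theta.1 (v0 R))
    (to_line R x).
Proof.
rewrite /tilde_density W0_eq0// addr0 rho_v0E; congr (expR (- _)).
set phi := theta.1; rewrite linearD linearD linearZ linearZ /=.
by rewrite [phi (sym2 1 0 0) * _]mulrC [phi (sym2 0 1 0) * _]mulrC.
Qed.

Lemma tilde_pE (A : set (borel_type X)) : measurable A ->
  tilde_p (rho R) (v0 R) nu theta A =
  (k%:num%:E * \int[lambda]_(x in @of_line R @^-1` A)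
    (quadratic_exp (theta.1 (sym2 1 0 0)) (theta.1 (sym2 0 1 0))
      (theta.1 (v0 R)) x)%:E)%E.
Proof.
move=> mA; rewrite /tilde_p; under eq_integral do rewrite tilde_densityE.
set q := quadratic_exp _ _ _.
have mq : measurable_fun A (fun x : borel_type X => (q (to_line R x))%:E).
  apply: measurable_funTS; apply/measurable_EFinP.
  exact: (measurableT_comp (@measurable_quadratic_exp _ _ _)
    (@measurable_to_line R)).
have [mu muE] := measure_pushforward lambda (@measurable_of_line R).
transitivity (\int[mscale k mu]_(x in A) (q (to_line R x))%:E)%E.
  by apply: eq_measure_integral => B mB _; rewrite nuE// -muE.
rewrite ge0_integral_mscale//; last by move=> x _; rewrite lee_fin expR_ge0.
congr (_ * _)%E.
(* The measure [mu] is known only by its values; the explicit pushforward allows the change of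
   variables. *)
transitivity (\int[pushforward lambda
    (@of_line R : measurableTypeR R -> borel_type X)]_(x in A)
    (q (to_line R x))%:E)%E.
  by apply: eq_measure_integral => [|mf B mB _];
    [exact: measurable_of_line|exact: muE].
rewrite ge0_integral_pushforward//; last 2 first.
- exact: measurable_of_line.
- by move=> x _; rewrite lee_fin expR_ge0.
by apply: eq_integral => x _ /=; rewrite of_lineK.
Qed.

End with_measure.
End normal_family.

(** * Matching the exponential family with the normal laws *)

Lemma probability_pushforward d1 d2 (T1 : measurableType d1)
    (T2 : measurableType d2) (R : realType) (P : probability T1 R)
    (f : T1 -> T2) :
  measurable_fun setT f ->
  exists Q : probability T2 R, forall A, Q A = P (f @^-1` A).
Proof.
move=> mf.
pose F : {mfun T1 >-> T2} := HB.pack f (isMeasurableFun.Build _ _ _ _ f mf).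
by exists (distribution P F).
Qed.

(** Lets the quadratic and linear coefficients of the exponent be prescribed freely. *)
Lemma Sym2_form (R : realType) (a b : R) :
  exists phi : 'Hom(Sym2 R, R^o),
    forall S, phi S = a * vsval S 0 0 + b * vsval S 0 1 :> R.
Proof.
pose f (S : Sym2 R) : R^o := a * vsval S 0 0 + b * vsval S 0 1.
have f_linear : linear f.
  move=> t S T; rewrite /f linearD linearZ/= !mxE.
  rewrite -[t *: _]/(t * _); ring.
pose F : {linear Sym2 R -> R^o} :=
  HB.pack f (GRing.isLinear.Build _ _ _ _ f f_linear).
by exists (linfun F) => S; rewrite lfunE.
Qed.

Section family_is_normal.
Variable R : realType.
Local Notation X := (coset_space (linear_part R)).
Variables (nu : {measure set (borel_type X) -> \bar R}) (k : {nonneg R}).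
Hypothesis k_gt0 : 0 < k%:num.
Hypothesis nuE : forall A, measurable A ->
  nu A = (k%:num%:E * lebesgue_measure (@of_line R @^-1` A))%E.
Variable theta : 'Hom(Sym2 R, R^o) * (affine_group R -> R).
Hypothesis theta_W0 : W0 (linear_part R) theta.2.

(** The constant [K] absorbs the scale [k] of [nu] and the value of [theta.1] at [v0]. *)
Lemma tilde_p_normal (m s : R) : 0 < s ->
  theta.1 (sym2 1 0 0) = (s ^+ 2 *+ 2)^-1 ->
  theta.1 (sym2 0 1 0) = - (m / s ^+ 2) ->
  exists2 K : R, 0 < K & forall A, measurable A ->
    tilde_p (rho R) (v0 R) nu theta A =
    (K%:E * normal_prob m s (@of_line R @^-1` A))%E.
Proof.
move=> s0 e1 e2.
have [K K0 qE] := quadratic_exp_normal_pdf m (theta.1 (v0 R)) s0.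
exists (k%:num * K) => [|A mA]; first exact: mulr_gt0.
rewrite (tilde_pE nuE)// e1 e2.
under eq_integral do rewrite qE EFinM.
rewrite ge0_integralZl_EFin ?(ltW K0)//.
- by rewrite muleA -EFinM.
- exact: measurable_preimage_of_line.
- by move=> x _; rewrite lee_fin normal_pdf_ge0.
- by apply/measurable_funTS/measurable_EFinP; exact: measurable_normal_pdf.
Qed.

(** Otherwise the Lebesgue integral is infinite, and the positive factor [k] keeps it so. *)
Lemma Theta_gt0 : (tilde_p (rho R) (v0 R) nu theta setT < +oo)%E ->
  0 < (theta.1 (sym2 1 0 0) : R).
Proof.
rewrite (tilde_pE nuE)// ltNge => fin; rewrite ltNge; apply/negP => a0.
move: fin; rewrite preimage_setT integral_quadratic_exp_nonpos//.
by rewrite gt0_muley ?lte_fin ?lexx.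
Qed.

(** A normal law has mass 1, so [K] is the total mass and cancels. *)
Lemma normalized_tilde_p_normal (m s : R) (A : set (borel_type X)) : 0 < s ->
  theta.1 (sym2 1 0 0) = (s ^+ 2 *+ 2)^-1 ->
  theta.1 (sym2 0 1 0) = - (m / s ^+ 2) ->
  measurable A ->
  (tilde_p (rho R) (v0 R) nu theta setT < +oo)%E /\
  ((fine (tilde_p (rho R) (v0 R) nu theta setT))^-1%:E *
    tilde_p (rho R) (v0 R) nu theta A)%E =
  normal_prob m s (@of_line R @^-1` A).
Proof.
move=> s0 e1 e2 mA; have [K K0 KE] := tilde_p_normal s0 e1 e2.
rewrite !KE// preimage_setT.
have -> : normal_prob m s setT = 1%E by exact: integral_normal_pdf.
rewrite mule1 ltry; split => //=.
by rewrite muleA -EFinM mulVf ?gt_eqF// mul1e.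
Qed.

End family_is_normal.

Lemma exp_family_normal (R : realType)
    (nu : {measure set (borel_type (coset_space (linear_part R))) -> \bar R}) :
  admissible_measure nu ->
  pushforward_family
    (to_line R : borel_type (coset_space (linear_part R)) -> measurableTypeR R)
    (exp_family (rho R) (v0 R) nu) = normal_family R.
Proof.
move=> /admissible_lebesgue[k k0 nuE]; apply/seteqP; split=> q.
- move=> [p [theta [W0theta fin] pE] qE].
  have a0 := Theta_gt0 k0 nuE W0theta fin.
  set a : R := theta.1 (sym2 1 0 0) in a0.
  (* The parameters [s] and [m] solve [1 / (2 s^2) = a] and [- m / s^2 = b], where [b] is the value
     of [theta.1] at [sym2 0 1 0]. *)
  pose s := Num.sqrt (a *+ 2)^-1.
  have a2 : 0 < (a *+ 2)^-1 by rewrite invr_gt0 mulrn_wgt0.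
  have s2 : s ^+ 2 = (a *+ 2)^-1 by rewrite sqr_sqrtr// ltW.
  have s0 : 0 < s by rewrite sqrtr_gt0.
  pose m : R := - (theta.1 (sym2 0 1 0) : R) * s ^+ 2.
  exists (s, m) => //= A mA; rewrite qE// /pushforward pE; last first.
    exact: measurable_preimage_to_line.
  have [||_ ->] := @normalized_tilde_p_normal _ _ _ k0 nuE _ W0theta m s
    (to_line R @^-1` A) s0 _ _ (measurable_preimage_to_line mA).
  + by rewrite -/a s2 -mulr_natr; field; rewrite gt_eqF.
  + by rewrite /m mulfK ?opprK// gt_eqF// exprn_gt0.
  by rewrite preimage_to_lineK.
- move=> [[s m]] /= s0 qE.
  (* Conversely, the form with these two coefficients, paired with the zero homomorphism, is a
     parameter yielding the given normal law. *)
  have [phi phiE] := Sym2_form (s ^+ 2 *+ 2)^-1 (- (m / s ^+ 2)).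
  have [p pE] :=
    probability_pushforward (normal_prob m s) (@measurable_of_line R).
  have W00 : W0 (linear_part R) (fun=> 0 : R).
    by split => // [|g h]; [exact: cst_continuous|rewrite addr0].
  have e1 : phi (sym2 1 0 0) = (s ^+ 2 *+ 2)^-1.
    by rewrite phiE !mxE/= mulr1 mulr0 addr0.
  have e2 : phi (sym2 0 1 0) = - (m / s ^+ 2).
    by rewrite phiE !mxE/= mulr1 mulr0 add0r.
  have main A := @normalized_tilde_p_normal _ _ _ k0 nuE (phi, fun=> 0) W00
    m s A s0 e1 e2.
  exists p; last first.
    by move=> A mA; rewrite qE// /pushforward pE preimage_to_lineK.
  exists (phi, fun=> 0).
    by split => //; have [] := main setT measurableT.
  by move=> A mA; have [_ ->] := main A mA; rewrite pE.
Qed.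

Theorem proposition4p3 (R : realType) :
  let G := affine_group R in
  let H := linear_part R in
  let X := coset_space H in
  [/\ fixed_by H (rho R) (v0 R),
      [/\ forall g : G, to_line R (coset_of H g) = trans g,
          continuous (to_line R : X -> R)
        & exists2 of_line : R -> X, continuous of_line
            & cancel (to_line R) of_line /\ cancel of_line (to_line R)],
      exists nu : {measure set (borel_type X) -> \bar R}, admissible_measure nu
    & forall nu : {measure set (borel_type X) -> \bar R},
        admissible_measure nu ->
        pushforward_family (to_line R : borel_type X -> measurableTypeR R)
          (exp_family (rho R) (v0 R) nu) = normal_family R].
Proof.
split.
- exact: fixed_by_v0.
- split; [exact: to_line_coset|exact: continuous_to_line|].
  exists (@of_line R); first exact: continuous_of_line.
  by split; [exact: to_lineK|exact: of_lineK].
- exact: exists_admissible.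
- exact: exp_family_normal.
Qed.
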